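(* Let $k$ be a field, let $H_4$ be the graph on the 12 vertices $v_{i,j}$ ($i\in\{0,1,2,3\}$, $j\in\mathbb Z_3$) in which $v_{i,j}v_{i,j'}$ is an edge for all $i$ and $j\ne j'$, $v_{i,j}v_{i+1,j}$ is an edge for $0\le i\le 2$, and $v_{0,j}v_{3,-j}$ is an edge for all $j\in\mathbb Z_3$ (no other edges). Identify the vertices with the variables of $R=k[x_1,\dots,x_{12}]$ and let $J=J(H_4)$ be the cover ideal of $H_4$. Then the depth function $s\mapsto \operatorname{depth}(R/J^s)$ is not non-increasing.
   Context: A transversal (vertex cover) of a graph $G$ is a set $T\subseteq V(G)$ meeting every edge. The cover ideal $J(G)$ is the ideal generated by the square-free monomials $\prod_{x\in T}x$ over all inclusion-wise minimal transversals $T$ of $G$. The depth function of an ideal $I$ of $R$ is $f(s)=\operatorname{depth}(R/I^s)$ for $s\ge 1$, where depth is the usual depth of a (graded) module over $R$. *)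

(* Defs.v *)
From HB Require Import structures.
From mathcomp Require Import all_boot all_order all_algebra.
From mathcomp Require Import boolp mpoly.

Set Implicit Arguments.
Unset Strict Implicit.
Unset Printing Implicit Defensive.

Import GRing.Theory.
Local Open Scope ring_scope.
Local Open Scope quotient_scope.

(* Ideals, possibly improper: the library's [idealr] asks for [1 \notin I]. *)
HB.mixin Record isMulAbsorbing (R : comNzRingType) (I : R -> bool) := {
  ideal_mul_subproof : forall a f, f \in (I : {pred R}) -> a * f \in (I : {pred R})
}.

#[short(type="ideal")]
HB.structure Definition Ideal (R : comNzRingType) :=
  {I of GRing.ZmodClosed R I & isMulAbsorbing R I}.

Lemma idealMl (R : comNzRingType) (I : ideal R) a f : f \in I -> a * f \in I.
Proof. exact: ideal_mul_subproof. Qed.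

Section GeneratedIdeals.
Variable R : comNzRingType.

(* Boolean by classical logic ([`[< _ >]]), so that the quotient construction
   of [ring_quotient] applies. *)
Definition ideal_gen (S : R -> Prop) : {pred R} := fun f =>
  `[< exists (n : nat) (c g : 'I_n -> R),
        (forall i, S (g i)) /\ f = \sum_i c i * g i >].

Lemma ideal_genP (S : R -> Prop) f :
  reflect (exists (n : nat) (c g : 'I_n -> R),
             (forall i, S (g i)) /\ f = \sum_i c i * g i)
          (f \in ideal_gen S).
Proof. exact: asboolP. Qed.

Lemma ideal_gen_mul (S : R -> Prop) a f :
  f \in ideal_gen S -> a * f \in ideal_gen S.
Proof.
case/ideal_genP=> n [c] [g] [Sg ->]; apply/ideal_genP.
exists n, (fun i => a * c i), g; split=> //.
by rewrite mulr_sumr; apply: eq_bigr => i _; rewrite mulrA.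
Qed.

Lemma ideal_gen_zmod_closed (S : R -> Prop) : zmod_closed (ideal_gen S).
Proof.
split=> [|f h].
  apply/ideal_genP; exists 0, (fun=> 0), (fun=> 0).
  by split=> [[] //|]; rewrite big_ord0.
case/ideal_genP=> n [c] [g] [Sg ->] /ideal_genP [m] [d] [l] [Sl ->].
apply/ideal_genP; exists (n + m)%N.
exists (fun i => match split i with inl j => c j | inr j => - d j end).
exists (fun i => match split i with inl j => g j | inr j => l j end).
split=> [i|]; first by case: (split i).
rewrite big_split_ord /= -sumrN; congr (_ + _); apply: eq_bigr => i _.
  by rewrite (unsplitK (inl _ i)).
by rewrite (unsplitK (inr _ i)) mulNr.
Qed.

HB.instance Definition _ (S : R -> Prop) :=
  GRing.isZmodClosed.Build R (ideal_gen S) (ideal_gen_zmod_closed S).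

HB.instance Definition _ (S : R -> Prop) :=
  isMulAbsorbing.Build R (ideal_gen S) (@ideal_gen_mul S).

Definition ideal_exp (I : {pred R}) (s : nat) : {pred R} :=
  ideal_gen (fun f => exists g : 'I_s -> R,
    (forall i, g i \in I) /\ f = \prod_i g i).

HB.instance Definition _ (I : {pred R}) (s : nat) := Ideal.on (ideal_exp I s).

End GeneratedIdeals.

Section QuotientModule.
Variables (R : comNzRingType) (I : ideal R).
Local Notation Q := {ideal_quot I}.

Definition quot_scale (a : R) (u : Q) : Q := \pi_Q (a * repr u).

Lemma pi_quot_scale a f : quot_scale a (\pi_Q f) = \pi_Q (a * f).
Proof.
apply/eqP; rewrite /quot_scale -Quotient.idealrBE -mulrBr; apply: idealMl.
by rewrite Quotient.idealrBE reprK.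
Qed.

Lemma quot_scaleA a b u : quot_scale a (quot_scale b u) = quot_scale (a * b) u.
Proof. by rewrite -[u]reprK (pi_quot_scale b) !pi_quot_scale mulrA. Qed.

Lemma quot_scale1 : left_id 1 quot_scale.
Proof. by move=> u; rewrite -[u]reprK pi_quot_scale mul1r. Qed.

Lemma quot_scaleDr : right_distributive quot_scale +%R.
Proof.
move=> a u v; rewrite -[u]reprK -[v]reprK -raddfD !pi_quot_scale.
by rewrite mulrDr raddfD.
Qed.

Lemma quot_scaleDl u : {morph quot_scale^~ u : a b / a + b}.
Proof. by move=> a b; rewrite -[u]reprK !pi_quot_scale mulrDl raddfD. Qed.

HB.instance Definition _ := GRing.Zmodule_isLmodule.Build R Q
  quot_scaleA quot_scale1 quot_scaleDr quot_scaleDl.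

Definition quotient_module : lmodType R := Q.

End QuotientModule.

Section RegularSequences.
Variables (R : comNzRingType) (M : lmodType R).
Implicit Types fs : seq R.

(* [u] lies in the submodule [(f_0, ..., f_{r-1}) M]. *)
Definition in_ideal_smul fs (u : M) : Prop :=
  exists w : 'I_(size fs) -> M, u = \sum_(i < size fs) fs`_i *: w i.

(* Multiplication by [f_i] is injective on [M / (f_0, ..., f_{i-1}) M], and
   [M / (f_0, ..., f_{r-1}) M] is not zero. *)
Definition regular_sequence fs : Prop :=
  (forall i, (i < size fs)%N -> forall u : M,
     in_ideal_smul (take i fs) (fs`_i *: u) -> in_ideal_smul (take i fs) u)
  /\ exists u : M, ~ in_ideal_smul fs u.

End RegularSequences.

(* Extended natural numbers: [None] is +oo. *)
Definition enat := option nat.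

Definition le_enat (a b : enat) : bool :=
  match a, b with
  | _, None => true
  | None, Some _ => false
  | Some m, Some n => (m <= n)%N
  end.

Lemma asbool_ex (P : nat -> Prop) : (exists n, P n) -> exists n, `[< P n >].
Proof. by case=> n Pn; exists n; apply/asboolP. Qed.

Lemma asbool_ub (P : nat -> Prop) b :
  (forall n, P n -> (n <= b)%N) -> forall n, `[< P n >] -> (n <= b)%N.
Proof. by move=> ub n /asboolP /ub. Qed.

Lemma sup_enat_exists (P : nat -> Prop) :
  exists a : enat, (forall n, P n -> le_enat (Some n) a) /\
    forall b : enat, (forall n, P n -> le_enat (Some n) b) -> le_enat a b.
Proof.
have [[b ub]|unb] := pselect (exists b, forall n, P n -> (n <= b)%N); last first.
  exists None; split=> // -[b ub|//]; case: unb; exists b; exact: ub.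
have [exP|nP] := pselect (exists n, P n); last first.
  by exists (Some 0%N); split=> [n Pn|[]//]; case: nP; exists n.
case: (ex_maxnP (asbool_ex exP) (asbool_ub ub)) => m /asboolP Pm max_m.
exists (Some m); split=> [n Pn|b']; last exact.
by apply: max_m; apply/asboolP.
Qed.

Definition sup_enat (P : nat -> Prop) : enat := sval (cid (sup_enat_exists P)).

Section Depth.
Variables (k : fieldType) (n : nat).

Definition irrelevant_ideal : {pred {mpoly k[n]}} :=
  ideal_gen (fun f => exists i : 'I_n, f = 'X_i).

(* The supremum of the lengths of the M-regular sequences in (x_1, ..., x_n). *)
Definition depth (M : lmodType {mpoly k[n]}) : enat :=
  sup_enat (fun r => exists fs : seq {mpoly k[n]},
    [/\ size fs = r, {subset fs <= irrelevant_ideal}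
      & regular_sequence M fs]).

End Depth.

Arguments irrelevant_ideal : clear implicits.

Section CoverIdeal.
Variables (V : finType) (e : rel V).

Definition transversal (T : {set V}) : bool :=
  [forall u, forall v, e u v ==> (u \in T) || (v \in T)].

Definition minimal_transversal (T : {set V}) : bool := minset transversal T.

(* [x u] is the index of the variable identified with the vertex [u]. *)
Definition cover_ideal (k : fieldType) (n : nat) (x : V -> 'I_n) :
    {pred {mpoly k[n]}} :=
  ideal_gen (fun f => exists2 T : {set V},
    minimal_transversal T & f = \prod_(u in T) 'X_(x u)).

Arguments cover_ideal k {n} x.

HB.instance Definition _ (k : fieldType) (n : nat) (x : V -> 'I_n) :=
  Ideal.on (cover_ideal k x).

End CoverIdeal.

Arguments cover_ideal {V} e k {n} x.

(* The vertex v_{i,j} is the pair (i, j). *)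
Definition H4_vertex : finType := ('I_4 * 'Z_3)%type.

Definition H4_arc (u v : H4_vertex) : bool :=
  [|| (u.1 == v.1) && (u.2 != v.2),
      (u.1.+1 == v.1 :> nat) && (u.2 == v.2)
    | [&& u.1 == 0%N :> nat, v.1 == 3%N :> nat & v.2 == - u.2]].

Definition H4 : rel H4_vertex := fun u v => H4_arc u v || H4_arc v u.

Lemma H4_sym : ssrbool.symmetric H4.
Proof. by move=> u v; rewrite /H4 orbC. Qed.

Lemma H4_irr : irreflexive H4.
Proof.
move=> [i j]; rewrite /H4 /H4_arc /= !eqxx /= orbb.
by rewrite gtn_eqF //=; case: eqP => // ->.
Qed.

Lemma card_H4_vertex : #|H4_vertex| = 12.
Proof. by rewrite card_prod !card_ord. Qed.

(* Main.v *)
(* A monomial [x^a] lies in [J^s] iff some [s] transversals cover each vertex [v]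
   at most [a v] times, i.e. (taking complements) iff each vertex [v] can be given
   [s - a v] of [s] colours so that adjacent vertices share no colour. Since H_4 is
   4-critical, the monomial [(x_1 ... x_12)^2] is not in [J^3] but all its multiples
   by a variable are, so [depth (R/J^3) = 0]. On the other hand no [x^a] outside
   [J^4] has all its multiples by a variable inside [J^4], which makes
   [x_1 + ... + x_12] a nonzero divisor on [R/J^4], so [depth (R/J^4) >= 1]. Indeed,
   put [b = 4 - a] for such an [a]: the triangles force each row of [b] to be
   [(1,1,1)] up to one entry 2. A search finds a colouring for all these [b], except
   when the entries 2 sit on four consecutive vertices of the 8-cycle of the Moebius
   ladder formed by the columns 1 and 2; then a 5-cycle of weight [9 > 2 * 4]
   obstructs the colouring, and still does after a multiplication by a variable of
   column 0. *)
Require Import Defs.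
From mathcomp Require Import all_boot all_order all_algebra.
From mathcomp Require Import mpoly.
From mathcomp Require Import boolp zify.

Set Implicit Arguments.
Unset Strict Implicit.
Unset Printing Implicit Defensive.

Import GRing.Theory.
Local Open Scope ring_scope.
Local Open Scope quotient_scope.

(** * Monomials in powers of a cover ideal *)

Lemma mem_ideal_mpoly (k : fieldType) (n : nat) (I : ideal {mpoly k[n]}) f :
  {in msupp f, forall m, 'X_[m] \in I} -> f \in I.
Proof.
move=> If; rewrite [f]mpolyE big_seq; apply: rpred_sum => m /If Im.
by rewrite -mul_mpolyC idealMl.
Qed.

Lemma mem_idealX_le (k : fieldType) (n : nat) (I : ideal {mpoly k[n]})
    (m m' : 'X_{1..n}) :
  (m <= m')%MM -> 'X_[m] \in I -> 'X_[m'] \in I.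
Proof. by move=> le_mm' Im; rewrite -(submK le_mm') mpolyXD idealMl. Qed.

Lemma mem_gen (R : comNzRingType) (S : R -> Prop) f : S f -> f \in ideal_gen S.
Proof.
move=> Sf; apply/ideal_genP; exists 1%N, (fun=> 1), (fun=> f).
by split=> //; rewrite big_ord1 mul1r.
Qed.

(** Each term of a combination of generators is a multiple of a term of one of them. *)
Lemma msupp_gen (k : fieldType) (n : nat) (S : {mpoly k[n]} -> Prop)
    (P : 'X_{1..n} -> Prop) :
  (forall m m', (m <= m')%MM -> P m -> P m') ->
  (forall g, S g -> {in msupp g, forall m, P m}) ->
  {in ideal_gen S, forall f, {in msupp f, forall m, P m}}.
Proof.
move=> upP PS f /ideal_genP[r [c [g [Sg ->]]]] m /msupp_sum_le/flattenP[ms].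
case/mapP=> i _ -> /msuppM_le/allpairsP[[m1 m2] /= [_ m2_g ->]].
by apply: upP (PS _ (Sg i) _ m2_g); apply: lem_addl.
Qed.

Lemma msupp_prod (k : fieldType) (n s : nat) (g : 'I_s -> {mpoly k[n]}) m :
  m \in msupp (\prod_(j < s) g j) ->
  exists2 h : 'I_s -> 'X_{1..n},
    (forall j, h j \in msupp (g j)) & m = (\sum_(j < s) h j)%MM.
Proof.
elim: s g m => [|s IHs] g m.
  rewrite big_ord0 msupp1 inE => /eqP->; exists (fun=> 0%MM); first by case.
  by rewrite big_ord0.
rewrite big_ord_recl => /msuppM_le/allpairsP[[m1 m2] /= [m1_g /IHs[h hg m2E] ->]].
exists (fun j => if unlift ord0 j is Some i then h i else m1).
  by move=> j; case: unliftP => [i|] ->.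
rewrite big_ord_recl unlift_none m2E; congr (_ + _)%MM.
by apply: eq_bigr => i _; rewrite liftK.
Qed.

Definition multicover (V : finType) (e : rel V) (s : nat) (a : V -> nat) : Prop :=
  exists T : 'I_s -> {set V}, (forall j, Defs.transversal e (T j)) /\
    forall v, (\sum_(j < s) (v \in T j) <= a v)%N.

Lemma multicover_le (V : finType) (e : rel V) s (a b : V -> nat) :
  (forall v, (a v <= b v)%N) -> multicover e s a -> multicover e s b.
Proof.
by move=> le_ab [T [trT aT]]; exists T; split=> // v; apply: leq_trans (le_ab v).
Qed.

Lemma msupp_cover_ideal_exp (V : finType) (e : rel V) (k : fieldType) (n : nat)
    (x : V -> 'I_n) s f m :
  f \in ideal_exp (cover_ideal e k x) s -> m \in msupp f ->
  multicover e s (fun v => m (x v)).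
Proof.
move=> Jf mf; pose P (m : 'X_{1..n}) := multicover e s (fun v => m (x v)).
apply: (msupp_gen (P := P)) Jf m mf => [m m' /mnm_lepP le_mm'|_ [g [Jg ->]] m].
  exact: multicover_le.
case/msupp_prod=> h hg ->.
have /choice[T TP] j : exists T : {set V},
    Defs.transversal e T /\ forall v, ((v \in T) <= h j (x v))%N.
  pose P1 (m : 'X_{1..n}) := exists T : {set V},
    Defs.transversal e T /\ forall v, ((v \in T) <= m (x v))%N.
  apply: (msupp_gen (P := P1)) (Jg j) (h j) (hg j)
    => [m1 m2 /mnm_lepP le12 [T [trT leT]]|_ [T minT ->] m1].
    by exists T; split=> // v; apply: leq_trans (le12 _).
  rewrite mprodXE => /mem_msuppXP <-; exists T.
  split=> [|v]; first by case/minsetP: minT.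
  case: (boolP (v \in T)) => // Tv.
  by rewrite mnm_sumE (bigD1 v) //= mnm1E eqxx.
exists T; split=> [j|v]; first by case: (TP j).
by rewrite mnm_sumE; apply: leq_sum => j _; case: (TP j).
Qed.

(** Shrinking the [T j] to minimal transversals gives a product of generators that divides
    ['X_[m]]. *)
Lemma mem_cover_ideal_exp (V : finType) (e : rel V) (k : fieldType) (n : nat)
    (x : V -> 'I_n) s (m : 'X_{1..n}) :
  injective x -> multicover e s (fun v => m (x v)) ->
  'X_[m] \in ideal_exp (cover_ideal e k x) s.
Proof.
move=> inj_x [T [trT leT]].
have /choice[M MP] j : exists M : {set V}, minimal_transversal e M /\ M \subset T j.
  by have [M minM sMT] := minset_exists (trT j); exists M.
apply: (@mem_idealX_le _ _ _ (\sum_(j < s) \sum_(u in M j) U_(x u))%MM).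
  apply/mnm_lepP => i; rewrite mnm_sumE.
  have [/codomP[v ->]|xNi] := boolP (i \in codom x); last first.
    rewrite big1 // => j _; rewrite mnm_sumE big1 // => u _.
    by rewrite mnm1E; case: eqP xNi => // <-; rewrite codom_f.
  apply: leq_trans (leT v); apply: leq_sum => j _; rewrite mnm_sumE.
  have [_ /subsetP sMT] := MP j.
  have [Mv|MNv] := boolP (v \in M j).
    rewrite (sMT v Mv) (bigD1 v) //= mnm1E eqxx big1 // => u /andP[_ ne_uv].
    by rewrite mnm1E (inj_eq inj_x) (negPf ne_uv).
  rewrite big1 // => u Mu; rewrite mnm1E (inj_eq inj_x).
  by case: eqP MNv => // <-; rewrite Mu.
apply: mem_gen; exists (fun j => \prod_(u in M j) 'X_(x u)); split=> [j|].
  by apply: mem_gen; exists (M j) => //; case: (MP j).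
by rewrite -mprodXE; apply: eq_bigr => j _; rewrite mprodXE.
Qed.

Lemma cover_ideal_expX (V : finType) (e : rel V) (k : fieldType) (n : nat)
    (x : V -> 'I_n) s (m : 'X_{1..n}) : injective x ->
  'X_[m] \in ideal_exp (cover_ideal e k x) s <->
  multicover e s (fun v => m (x v)).
Proof.
move=> inj_x; split; last exact: mem_cover_ideal_exp.
by move/msupp_cover_ideal_exp; apply; rewrite msuppX mem_head.
Qed.

(** * Depth of quotient modules *)

Lemma in_ideal_smul_nil (R : comNzRingType) (M : lmodType R) (u : M) :
  in_ideal_smul [::] u <-> u = 0.
Proof.
split=> [[w ->]|->]; first by rewrite big_ord0.
by exists (fun=> 0); rewrite big_ord0.
Qed.

Lemma quotient_module_eq0 (R : comNzRingType) (I : ideal R) (f : R) :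
  \pi_{ideal_quot I} f = 0 :> quotient_module I <-> f \in I.
Proof.
rewrite -[f in f \in I]subr0 Quotient.idealrBE; split=> [->|/eqP->].
  by rewrite raddf0.
by rewrite raddf0.
Qed.

Lemma scale_pi (R : comNzRingType) (I : ideal R) (a f : R) :
  a *: (\pi_{ideal_quot I} f : quotient_module I) = \pi_{ideal_quot I} (a * f).
Proof. exact: pi_quot_scale. Qed.

Lemma le_sup_enat (P : nat -> Prop) r : P r -> le_enat (Some r) (sup_enat P).
Proof. by rewrite /sup_enat => Pr; case: cid => a /= [ub _]; exact: ub. Qed.

Lemma sup_enat_le (P : nat -> Prop) b :
  (forall r, P r -> le_enat (Some r) b) -> le_enat (sup_enat P) b.
Proof. by rewrite /sup_enat => ub; case: cid => a /= [_ lub]; exact: lub. Qed.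

Lemma le_enat_trans a b c : le_enat a b -> le_enat b c -> le_enat a c.
Proof. by case: a b c => [a|] [b|] [c|] //=; apply: leq_trans. Qed.

(** The irrelevant ideal kills the nonzero class of [u], so no regular sequence can begin. *)
Lemma depth_quotient_le0 (k : fieldType) (n : nat) (I : ideal {mpoly k[n]}) u :
  u \notin I -> (forall i, 'X_i * u \in I) ->
  le_enat (depth (quotient_module I)) (Some 0%N).
Proof.
move=> INu IXu; apply: sup_enat_le => r [[|f fs] [<- // sub_fs [reg _]]].
case/negP: INu; apply/quotient_module_eq0/in_ideal_smul_nil.
apply: (reg 0%N) => //=; apply/in_ideal_smul_nil.
rewrite scale_pi; apply/quotient_module_eq0.
have /ideal_genP[m [c [g [gX ->]]]] := sub_fs f (mem_head f fs).
rewrite mulr_suml; apply: rpred_sum => i _; rewrite -mulrA idealMl //.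
by have [j ->] := gX i.
Qed.

Lemma mcoeff_sumXM (k : fieldType) (n : nat) (u : {mpoly k[n]}) (m : 'X_{1..n}) :
  ((\sum_(j < n) 'X_j) * u)@_m = \sum_(j < n | m j != 0%N) u@_(m - U_(j)).
Proof.
rewrite mulr_suml linear_sum /= [RHS]big_mkcond /=; apply: eq_bigr => j _.
rewrite mulrC; case: ifP => [mj|/eqP mj].
  have /submK mE: (U_(j) <= m)%MM by rewrite lep1mP.
  by rewrite -{1}mE addmC mcoeffMX.
apply/memN_msupp_eq0/negP; rewrite (perm_mem (msuppMX _ _)) => /mapP[m' _ mE].
by move: mj; rewrite mE mnmDE mnm1E eqxx.
Qed.

(** * The sum of the variables as a nonzero divisor *)

Section SumOfVariables.
Variables (k : fieldType) (n : nat) (I : ideal {mpoly k[n]}).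
Hypothesis mono_I : {in I, forall f, {in msupp f, forall m, 'X_[m] \in I}}.
Hypothesis sat_I : forall m : 'X_{1..n},
  'X_[m] \notin I -> exists i, 'X_[m + U_(i)] \notin I.

(** If the ray in each direction [i] met [I] at step [N i], a path outside [I] of length
    [\sum_i N i + 1], given by [sat_I], would exceed [N i] in some direction. *)
Lemma saturated_monomial_ray (m : 'X_{1..n}) : 'X_[m] \notin I ->
  exists i, forall N, 'X_[m + U_(i) *+ N] \notin I.
Proof.
move=> INm; apply: contrapT => /forallNP noray.
have /choice[N IN] i : exists N, 'X_[m + U_(i) *+ N] \in I.
  have /existsNP[N /negP] := noray i; rewrite negbK => IN; by exists N.
have [m' degm' INm'] : exists2 m' : 'X_{1..n},
    mdeg m' = (\sum_i N i).+1 & 'X_[m + m'] \notin I.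
  elim: (_.+1) => [|D [m' <- /sat_I[i INi]]].
    by exists 0%MM; rewrite ?mdeg0 // addm0.
  by exists (m' + U_(i))%MM; rewrite ?mdegD ?mdeg1 ?addn1 // addmA.
suff: (mdeg m' <= \sum_i N i)%N by rewrite degm' ltnn.
rewrite mdegE; apply: leq_sum => i _; rewrite leqNgt; apply: contra INm' => ltN.
apply: mem_idealX_le (IN i); apply/mnm_lepP => j.
rewrite !mnmDE leq_add2l mulmnE mnm1E.
by case: eqP => [<-|]; rewrite ?mul1n // ltnW.
Qed.

Lemma sum_variables_regular u : (\sum_(j < n) 'X_j) * u \in I -> u \in I.
Proof.
move=> Ifu; apply: mem_ideal_mpoly => m0 um0; apply/negPn/negP.
case/saturated_monomial_ray=> i ray0.
pose ray (m : 'X_{1..n}) := forall N, 'X_[m + U_(i) *+ N] \notin I.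
(* For [m] of largest [x_i]-degree, no other term of [u] contributes to the
   coefficient of [x_i m] in [(x_1 + ... + x_n) u]. *)
have [m [um raym maxm]] : exists m, [/\ m \in msupp u, ray m
    & forall m', m' \in msupp u -> ray m' -> (m' i <= m i)%N].
  pose P d := `[< exists m, [/\ m \in msupp u, ray m & m i = d] >].
  have exP : exists d, P d by exists (m0 i); apply/asboolP; exists m0.
  have ubP d : P d -> (d <= \max_(m <- msupp u) m i)%N.
    by case/asboolP=> m [um _ <-]; apply: leq_bigmax_seq.
  case: (ex_maxnP exP ubP) => d /asboolP[m [um raym <-]] maxd.
  by exists m; split=> // m' um' raym'; apply: maxd; apply/asboolP; exists m'.
suff: 'X_[m + U_(i)] \in I by move/negP: (raym 1%N); rewrite mulm1n.
apply: (mono_I Ifu); rewrite mcoeff_msupp mcoeff_sumXM (bigD1 i) /=; last first.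
  by rewrite mnmDE mnm1E eqxx addn1.
rewrite addmK big1 ?addr0 -?mcoeff_msupp // => j /andP[mj ne_ji].
apply/memN_msupp_eq0/negP => um'.
(* Otherwise [m x_i / x_j] is a term of [u] of larger [x_i]-degree, and its ray avoids [I] because
   the ray of [m] does. *)
suff /(maxm _ um') : ray (m + U_(i) - U_(j))%MM.
  by rewrite mnmBE mnmDE !mnm1E eqxx (negPf ne_ji) subn0 addn1 ltnn.
move=> N; apply: contra (raym N.+1); apply: mem_idealX_le.
rewrite mulmS addmA; apply/mnm_lepP => l.
by rewrite 2!mnmDE leq_add2r mnmBE leq_subr.
Qed.

Lemma depth_quotient_ge1 : {in I, forall f, f@_0 = 0} ->
  le_enat (Some 1%N) (depth (quotient_module I)).
Proof.
move=> I0; apply: le_sup_enat; exists [:: \sum_(j < n) 'X_j]; split=> //.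
  move=> _ /[1!inE] /eqP->; apply: rpred_sum => j _; apply: mem_gen.
  by exists j.
split=> [[|//] _ u|].
  rewrite -[u]reprK /= scale_pi.
  move=> /in_ideal_smul_nil/quotient_module_eq0/sum_variables_regular Iu.
  exact/in_ideal_smul_nil/quotient_module_eq0.
(* Constant terms show that 1 is not in [I + (x_1 + ... + x_n)]. *)
exists (\pi_{ideal_quot I} 1) => -[w].
rewrite big_ord1 /= -[w ord0]reprK scale_pi => /eqP.
rewrite -Quotient.idealrBE => /I0/eqP.
rewrite mcoeffB mcoeff1 eqxx mcoeff_sumXM big_pred0 ?subr0 ?oner_eq0 //.
by move=> j; rewrite mnm0E.
Qed.

End SumOfVariables.

(** * Multicovers and packings of independent sets *)

Local Open Scope nat_scope.

Lemma transversal_edge (V : finType) (e : rel V) (T : {set V}) u v :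
  Defs.transversal e T -> e u v -> (u \in T) || (v \in T).
Proof. by move=> /forallP/(_ u)/forallP/(_ v)/implyP. Qed.

(** Double counting of the incidences between the [s] transversals and the places of [r]. *)
Lemma multicover_count (V : finType) (e : rel V) s (a : V -> nat) (r : seq V) c :
  (forall T : {set V}, Defs.transversal e T -> c <= count (mem T) r) ->
  multicover e s a -> s * c <= \sum_(v <- r) a v.
Proof.
move=> cr [T [trT aT]]; apply: (@leq_trans (\sum_(v <- r) \sum_(j < s) (v \in T j))).
  rewrite exchange_big /= -[s in s * c]card_ord -sum_nat_const.
  apply: leq_sum => j _; apply: leq_trans (cr _ (trT j)) _.
  by rewrite -sum1_count big_mkcond.
exact: leq_sum.
Qed.

(** Indices wrap modulo 4 and 3, which lets the row index run along the Moebius cycle. *)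
Definition vtx (i j : nat) : H4_vertex := (inZp i, inZp j).

Lemma vtxK (v : H4_vertex) : vtx v.1 v.2 = v.
Proof. by case: v => i j; rewrite /vtx !valZpK. Qed.

(* The word [w] selects the vertices [v_(i, w_i)], which form an independent set
   exactly when [w] is valid; the sum modulo 3 stands for the edges
   [v_(0, j) v_(3, -j)]. *)
Definition valid_word (w : seq nat) : bool :=
  [&& nth 0 w 0 != nth 0 w 1, nth 0 w 1 != nth 0 w 2, nth 0 w 2 != nth 0 w 3
    & (nth 0 w 0 + nth 0 w 3) %% 3 != 0].

Definition word_cover (w : seq nat) : {set H4_vertex} :=
  [set v : H4_vertex | nth 0 w v.1 != v.2].

Lemma word_cover_transversal w :
  valid_word w -> Defs.transversal H4 (word_cover w).
Proof.
move=> /and4P[w01 w12 w23 w30]; apply/forallP => u; apply/forallP => v.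
apply/implyP; rewrite !inE -negb_and => Huv; apply/negP => /andP[/eqP wu /eqP wv].
suff arcF (u' v' : H4_vertex) :
    nth 0 w u'.1 = u'.2 -> nth 0 w v'.1 = v'.2 -> ~~ H4_arc u' v'.
  by move: Huv; rewrite /H4 (negPf (arcF u v _ _)) // (negPf (arcF v u _ _)).
case: u' v' => [i j] [i' j'] /= wij wij'; apply/negP => /or3P[] /=.
- move=> /andP[/eqP eqi /negP[]]; apply/eqP/val_inj => /=.
  by rewrite -wij -wij' eqi.
- move=> /andP[/eqP eqi /eqP eqj]; move: wij'; rewrite -eqj -wij -eqi => /esym.
  have := ltn_ord i'; rewrite -eqi.
  by case: (val i) => [|[|[|]]] // _ /eqP; rewrite (negPf w01, negPf w12, negPf w23).
case/and3P=> /eqP i0 /eqP i3 /eqP jE; move: w30 wij wij'.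
rewrite i0 i3 jE => w30 w0 w3; move: w30; rewrite w0 w3 /= modnDmr subnKC ?modnn //.
exact/ltnW/ltn_ord.
Qed.

Definition words : seq (seq nat) :=
  [seq w <- [seq [:: x.1.1; x.1.2; x.2.1; x.2.2] |
      x <- [seq (x, y) | x <- [seq (a, b) | a <- iota 0 3, b <- iota 0 3],
                         y <- [seq (a, b) | a <- iota 0 3, b <- iota 0 3]]] |
    valid_word w].

Definition total (b : nat -> nat -> nat) : nat :=
  sumn [seq b i j | i <- iota 0 4, j <- iota 0 3].

(* Searches for [s] valid words selecting each vertex [v_(i, j)] at least
   [b i j] times; each of them accounts for at most 4 units of [total b]. *)
Fixpoint packable (s : nat) (b : nat -> nat -> nat) : bool :=
  if s is s'.+1 then
    has (fun w => let b' i j := b i j - (nth 0 w i == j) in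
                  (total b' <= 4 * s') && packable s' b') words
  else total b == 0.

Lemma packableP s b : packable s b ->
  exists ws, [/\ size ws = s, all valid_word ws
    & forall i j, i < 4 -> j < 3 -> b i j <= count (fun w => nth 0 w i == j) ws].
Proof.
elim: s b => [|s IHs] b.
  rewrite /= /total /= => b0; exists [::]; split=> // i j.
  by case: i j => [|[|[|[|]]]] // [|[|[|]]] // _ _; lia.
case/hasP=> w /[!mem_filter] /andP[vw _] /andP[_ /IHs[ws [<- vws cws]]].
exists (w :: ws); split=> //= [|i j lti ltj]; first by rewrite vw.
by rewrite -leq_subLR cws.
Qed.

(** By complements: a vertex selected at least [b] times by [s] words is covered at most [s - b]
    times. *)
Lemma multicover_packable s b (a : H4_vertex -> nat) : packable s b ->
  (forall v, s <= a v + b v.1 v.2) -> multicover H4 s a.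
Proof.
case/packableP=> ws [<- /allP vws cws] le_s.
exists (fun j => word_cover (nth [::] ws j)); split=> [j|v].
  by apply/word_cover_transversal/vws/mem_nth.
rewrite -(big_mkord xpredT (fun j => (v \in word_cover (nth [::] ws j)) : nat)).
rewrite -(big_nth [::] xpredT (fun w => (v \in word_cover w) : nat)).
under eq_bigr => w _ do rewrite inE.
rewrite -big_mkcond sum1_count -(leq_add2r (count (fun w => nth 0 w v.1 == v.2) ws)).
rewrite addnC (count_predC (fun w => nth 0 w v.1 == v.2)).
by apply: leq_trans (le_s v) _; rewrite leq_add2l cws.
Qed.

(** * 4-criticality of H_4 *)

(** The packing found for [v] amounts to a 3-colouring of [H_4 - v]. *)
Lemma multicover_H4_less3 v : multicover H4 3 (fun u => 2 + (u == v)).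
Proof.
have : all (fun i => all (fun j =>
    packable 3 (fun i' j' => ((i', j') != (i, j)) : nat)) (iota 0 3)) (iota 0 4).
  by lazy.
move=> /allP/(_ (val v.1)); rewrite mem_iota ltn_ord => /(_ isT).
move=> /allP/(_ (val v.2)); rewrite mem_iota ltn_ord => /(_ isT).
move/multicover_packable; apply=> u.
have -> : ((val u.1, val u.2) != (val v.1, val v.2)) = (u != v).
  by case: u v => [i j] [i' j']; rewrite !xpair_eqE.
by case: (u == v).
Qed.

(* A permutation of Z_3 is [j |-> a + s j] with [s = 1] or [s = -1]. If [s != s'],
   then [a + s j] and [a' + s' j] agree at some [j]: in a 3-colouring, all the
   rows have the same [s], which the twist [j |-> - j] from row 3 to row 0 forbids. *)
Lemma rotation_adjacent a b c a' b' c' :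
  uniq [:: a; b; c] -> uniq [:: a'; b'; c'] -> a != a' -> b != b' -> c != c' ->
  all (gtn 3) [:: a; b; c; a'; b'; c'] ->
  (a.+1 %% 3 == b) = (a'.+1 %% 3 == b').
Proof.
case: a b c => [|[|[|a]]] // [|[|[|b]]] // [|[|[|c]]] //; rewrite ?andbF //;
by case: a' b' c' => [|[|[|a']]] // [|[|[|b']]] // [|[|[|c']]] //; rewrite ?andbF //.
Qed.

Lemma not_multicover_H4_3 : ~ multicover H4 3 (fun=> 2).
Proof.
case=> T [trT leT].
(* The colour of [v] is the index of a transversal missing it: [v] lies in at most 2 of the 3. *)
have /choice[c cT] v : exists j, v \notin T j.
  apply/existsP; rewrite -negb_forall; apply/forallP => allT.
  suff: \sum_(j < 3) (v \in T j) = 3 by move=> sum3; have := leT v; rewrite sum3.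
  by rewrite (eq_bigr (fun=> 1)) ?sum1_card ?card_ord // => j _; rewrite allT.
have cP u v : H4 u v -> val (c u) != val (c v).
  move=> Huv; apply/negP => /eqP/val_inj eqc.
  by have := transversal_edge (trT (c u)) Huv; rewrite {2}eqc !(negPf (cT _)).
pose d i j : nat := c (vtx i j).
have dlt i j : d i j < 3 by apply: ltn_ord.
have row i : i < 4 -> uniq [:: d i 0; d i 1; d i 2].
  by case: i => [|[|[|[|]]]] // _; rewrite /= !inE negb_or !cP.
have step i : i < 3 -> (((d i 0).+1 %% 3 == d i 1) = ((d i.+1 0).+1 %% 3 == d i.+1 1)).
  move=> lti; apply: (@rotation_adjacent _ _ (d i 2) _ _ (d i.+1 2)).
  - exact/row/ltnW.
  - exact: row.
  - by case: i lti => [|[|[|]]] // _; apply: cP.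
  - by case: i lti => [|[|[|]]] // _; apply: cP.
  - by case: i lti => [|[|[|]]] // _; apply: cP.
  by rewrite /= !dlt.
(* Columns 1 and 2 of row 3 are swapped to follow the edges [v_(0, j) v_(3, -j)]. *)
have: ((d 0 0).+1 %% 3 == d 0 1) = ((d 3 0).+1 %% 3 == d 3 2).
  apply: (@rotation_adjacent _ _ (d 0 2) _ _ (d 3 1)); rewrite ?row ?cP //.
    have := row 3 isT; rewrite /= !inE !negb_or => /andP[/andP[-> ->]].
    by rewrite eq_sym => ->.
  by rewrite /= !dlt.
rewrite (step 0) // (step 1) // (step 2) //.
move: (row 3 isT) (dlt 3 0) (dlt 3 1) (dlt 3 2).
by case: (d 3 0) (d 3 1) (d 3 2) => [|[|[|a]]] // [|[|[|b]]] // [|[|[|e]]].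
Qed.

(** * Saturation of the fourth power *)

(* Columns 1 and 2 of H_4 span a Moebius ladder: [moebius t] runs along its 8-cycle,
   with rungs [moebius t -- moebius (t + 4)]. *)
Definition column (t : nat) : nat := if t %% 8 < 4 then 1 else 2.

Definition moebius (t : nat) : H4_vertex := vtx t (column t).

Lemma H4_moebius t : t < 12 ->
  H4 (moebius t) (moebius t.+1) && H4 (moebius t) (moebius (t + 4)).
Proof.
move=> ltt; have /allP/(_ t) : all (fun t => H4 (moebius t) (moebius t.+1) &&
    H4 (moebius t) (moebius (t + 4))) (iota 0 12) by lazy.
by apply; rewrite mem_iota.
Qed.

(* [p] gives for each row the column of the entry 2 of [b]. *)
Definition consecutive (p : seq nat) : bool :=
  has (fun t => all (fun d => nth 0 p ((t + d) %% 4) == column (t + d)) (iota 0 4))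
    (iota 0 8).

Lemma forall_ternary4 (P : pred (seq nat)) :
  all (fun a => all (fun b => all (fun c => all (fun d => P [:: a; b; c; d])
    (iota 0 3)) (iota 0 3)) (iota 0 3)) (iota 0 3) ->
  forall a b c d, a < 3 -> b < 3 -> c < 3 -> d < 3 -> P [:: a; b; c; d].
Proof.
move=> allP4 a b c d lta ltb ltc ltd.
move: allP4 => /allP/(_ a); rewrite mem_iota => /(_ lta)/allP/(_ b).
rewrite mem_iota => /(_ ltb)/allP/(_ c); rewrite mem_iota => /(_ ltc)/allP/(_ d).
by rewrite mem_iota; apply.
Qed.

Lemma packable_or_consecutive a b c d : a < 3 -> b < 3 -> c < 3 -> d < 3 ->
  packable 4 (fun i j => (j == nth 0 [:: a; b; c; d] i).+1)
  || consecutive [:: a; b; c; d].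
Proof.
move: a b c d; apply: (@forall_ternary4 (fun p =>
  packable 4 (fun i j => (j == nth 0 p i).+1) || consecutive p)).
by lazy.
Qed.

(* The rung from the first of the five vertices to the last one closes a 5-cycle. *)
Lemma transversal_moebius (T : {set H4_vertex}) t :
  Defs.transversal H4 T -> t < 8 ->
  3 <= count (mem T) [seq moebius (t + d) | d <- iota 0 5].
Proof.
move=> trT ltt.
have edge d : d < 4 -> (moebius (t + d) \in T) || (moebius (t + d).+1 \in T).
  move=> ltd; apply: transversal_edge trT _.
  by have /andP[] : _ := @H4_moebius (t + d) ltac:(lia).
have chord : (moebius (t + 0) \in T) || (moebius (t + 4) \in T).
  apply: transversal_edge trT _.
  by have /andP[_] : _ := @H4_moebius t ltac:(lia); rewrite addn0.
move: chord (edge 0 isT) (edge 1 isT) (edge 2 isT) (edge 3 isT).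
rewrite /= -!addnS.
by do 5 case: (_ \in T).
Qed.

Lemma H4_row i j j' : j < 3 -> j' < 3 -> j != j' -> H4 (vtx i j) (vtx i j').
Proof.
move=> ltj ltj' ne_jj'.
by rewrite /H4 /H4_arc /= eqxx -val_eqE /= (modn_small ltj) (modn_small ltj') ne_jj'.
Qed.

Lemma transversal_row (T : {set H4_vertex}) i : Defs.transversal H4 T ->
  2 <= count (mem T) [:: vtx i 0; vtx i 1; vtx i 2].
Proof.
move=> trT; have edge j j' ltj ltj' ne_jj' :=
  transversal_edge trT (@H4_row i j j' ltj ltj' ne_jj').
move: (edge 0 1 isT isT isT) (edge 0 2 isT isT isT) (edge 1 2 isT isT isT) => /=.
by do 3 case: (_ \in T).
Qed.

Lemma multicover_H4_saturated (a : H4_vertex -> nat) :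
  (forall v, multicover H4 4 (fun u => a u + (u == v))) -> multicover H4 4 a.
Proof.
move=> cov; apply: contrapT => Ncov.
(* Four transversals respect any bound of at least 4 at [v], so the cover for [a] raised at [v]
   would serve for [a]. *)
have le3 v : a v <= 3.
  rewrite leqNgt; apply/negP => gt3; apply: Ncov.
  have [T [trT leT]] := cov v; exists T; split=> // u.
  have [->|ne_uv] := eqVneq u v; last by have := leT u; rewrite (negPf ne_uv) addn0.
  apply: leq_trans gt3.
  apply: (@leq_trans (\sum_(j < 4) 1)); last by rewrite sum1_card card_ord.
  by apply: leq_sum => j _; case: (_ \in _).
(* Raising [a] in the next row leaves row [i] unchanged, so its triangle forces a sum of at least
   [4 * 2]. *)
have row i : i < 4 -> 8 <= a (vtx i 0) + a (vtx i 1) + a (vtx i 2).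
  move=> lti; have := multicover_count (fun T trT => @transversal_row T i trT)
    (cov (vtx i.+1 0)).
  rewrite !big_cons big_nil.
  have ne j : (vtx i j == vtx i.+1 0) = false.
    by case: i lti => [|[|[|[|]]]] // _; rewrite xpair_eqE.
  by rewrite !ne; lia.
(* At most one entry of a row is below 3. The values 1 and 2 of [p i] certify such an entry; 0 is
   also the default when there is none. *)
pose p i := if a (vtx i 1) <= 2 then 1 else if a (vtx i 2) <= 2 then 2 else 0.
have plt i : p i < 3 by rewrite /p; case: ifP => // _; case: ifP.
have le_p i j : i < 4 -> j < 3 -> 4 <= a (vtx i j) + (j == p i).+1.
  move=> /row; have := (le3 (vtx i 0), le3 (vtx i 1), le3 (vtx i 2)).
  rewrite /p; case: j => [|[|[|]]] //= [[? ?] ?] ? _;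
  (case: ifP => /= ?; last (case: ifP => /= ?)); lia.
have nthp i : i < 4 -> nth 0 [:: p 0; p 1; p 2; p 3] i = p i.
  by case: i => [|[|[|[|]]]].
have /orP[|] := packable_or_consecutive (plt 0) (plt 1) (plt 2) (plt 3).
  move/multicover_packable => cov4; apply: Ncov; apply: cov4 => v.
  have := le_p _ _ (ltn_ord v.1) (ltn_ord v.2); rewrite vtxK.
  by rewrite nthp.
case/hasP=> t; rewrite mem_iota => ltt /allP pt.
have le2 d : d < 4 -> a (moebius (t + d)) <= 2.
  move=> ltd; have := pt d; rewrite mem_iota => /(_ ltd)/eqP.
  have -> : moebius (t + d) = vtx ((t + d) %% 4) (column (t + d)).
    by congr pair; apply/val_inj; rewrite /= modn_mod.
  rewrite nthp ?ltn_pmod // /column /p.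
  by do ?case: ifP => //.
(* The 5-cycle avoids column 0, so raising [a] at [v_(0, 0)] keeps its sum, at most
   [4 * 2 + 3 = 11]; four transversals need [4 * 3 = 12]. *)
have := multicover_count (fun T trT => @transversal_moebius T t trT ltt)
  (cov (vtx 0 0)).
have ne d : (moebius d == vtx 0 0) = false.
  by rewrite xpair_eqE /column; case: ifP; rewrite andbF.
rewrite big_map !big_cons big_nil !ne.
move: (le2 0 isT) (le2 1 isT) (le2 2 isT) (le2 3 isT) (le3 (moebius (t + 4))).
lia.
Qed.

Theorem theorem3p4 (k : fieldType) (x : H4_vertex -> 'I_12) (hx : bijective x) :
  ~ (forall s t : nat, (1 <= s)%N -> (s <= t)%N ->
       le_enat (depth (quotient_module (ideal_exp (cover_ideal H4 k x) t)))
               (depth (quotient_module (ideal_exp (cover_ideal H4 k x) s)))).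
Proof.
have inj_x := bij_inj hx; have [y yK xK] := hx.
have depth3 : le_enat
    (depth (quotient_module (ideal_exp (cover_ideal H4 k x) 3))) (Some 0).
  apply: (@depth_quotient_le0 _ _ _ 'X_[[multinom 2 | _ < 12]]) => [|i].
    apply/negP => /(cover_ideal_expX _ _ _ _ inj_x)/(multicover_le (b := fun=> 2)).
    by move=> cov; apply/not_multicover_H4_3/cov => v; rewrite mnmE.
  rewrite -mpolyXD; apply/(cover_ideal_expX _ _ _ _ inj_x).
  apply: multicover_le (multicover_H4_less3 (y i)) => u.
  by rewrite mnmDE mnmE mnm1E addnC -{2}(xK i) (inj_eq inj_x) eq_sym.
have depth4 : le_enat (Some 1)
    (depth (quotient_module (ideal_exp (cover_ideal H4 k x) 4))).
  apply: depth_quotient_ge1 => [f Jf m mf|m Jm|f Jf].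
  - exact/(cover_ideal_expX _ _ _ _ inj_x)/(msupp_cover_ideal_exp Jf).
  - apply: contrapT => /forallNP satm; move/negP: Jm; apply.
    apply/(cover_ideal_expX _ _ _ _ inj_x)/multicover_H4_saturated => v.
    have /negP := satm (x v); rewrite negbK => /(cover_ideal_expX _ _ _ _ inj_x).
    by apply: multicover_le => u; rewrite mnmDE mnm1E (inj_eq inj_x) eq_sym.
  (* The zero exponent violates the triangle bound in row 0. *)
  apply/memN_msupp_eq0/negP => /(msupp_cover_ideal_exp Jf).
  move/(multicover_count (fun T trT => @transversal_row T 0 trT)).
  by rewrite !big_cons big_nil !mnm0E.
move=> /(_ 3 4 isT isT) le43.
by have := le_enat_trans depth4 (le_enat_trans le43 depth3).
Qed.
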